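(* Let $L_{U_1},\ldots,L_{U_t}$ be $t$ mutually disjoint scattered $\mathbb{F}_q$-linear sets in $\mathrm{PG}(k-1,q^m)$ of ranks $n_1\ge\cdots\ge n_t\geq 1$, respectively, with $L_{U_1}\cup\cdots\cup L_{U_t}\neq\mathrm{PG}(k-1,q^m)$, and such that $U_1\cap\cdots\cap U_t$ contains no $1$-dimensional $\mathbb{F}_{q^m}$-subspace. Let $\mathcal{C}=\mathcal{C}(U_1^{\perp'},\ldots,U_t^{\perp'})$ be the geometric dual of a code associated with $(U_1,\ldots,U_t)$, i.e. a code associated with $(U_1^{\perp'},\ldots,U_t^{\perp'})$. Then $\mathcal{C}$ has parameters $[(mk-n_1,\ldots,mk-n_t),k]_{q^m/q}$ and it has exactly two distinct nonzero weights: \[ tm\quad\text{and}\quad tm-1. \] Moreover, the set of rank-lists of the nonzero codewords of $\mathcal{C}$ is \[ S(\mathcal{C})=\{(m,\ldots,m),(m-1,m,\ldots,m),(m,m-1,m,\ldots,m),\ldots,(m,\ldots,m,m-1)\}. \]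
   Context: Let $q$ be a prime power. For $\mathbf{n}=(n_1,\ldots,n_t)$ put $\mathbb{F}_{q^m}^{\mathbf{n}}=\bigoplus_{i=1}^t\mathbb{F}_{q^m}^{n_i}$ (block lengths of codes need not be ordered here). The rank of $v\in\mathbb{F}_{q^m}^n$ is the $\mathbb{F}_q$-dimension of the $\mathbb{F}_q$-span of its entries; the rank-list of $x=(x_1,\ldots,x_t)$ is $(\mathrm{rk}(x_1),\ldots,\mathrm{rk}(x_t))$, and its sum-rank weight is $\sum_i\mathrm{rk}(x_i)$. An $[\mathbf{n},k]_{q^m/q}$ code is a $k$-dimensional $\mathbb{F}_{q^m}$-subspace of $\mathbb{F}_{q^m}^{\mathbf{n}}$ with the sum-rank distance (weight of the difference). A code associated with a tuple $(V_1,\ldots,V_t)$ of $\mathbb{F}_q$-subspaces of $\mathbb{F}_{q^m}^k$ whose $\mathbb{F}_{q^m}$-span is $\mathbb{F}_{q^m}^k$ is the code generated by $(G_1|\cdots|G_t)$, where the columns of $G_i$ form an $\mathbb{F}_q$-basis of $V_i$. Dual: fix a nondegenerate reflexive sesquilinear form $\sigma$ on $V=\mathbb{F}_{q^m}^k$ and let $\sigma'(x,y)=\mathrm{Tr}_{q^m/q}(\sigma(x,y))$, regarded as a nondegenerate reflexive sesquilinear form on $V$ seen as a $km$-dimensional $\mathbb{F}_q$-space. For an $\mathbb{F}_q$-subspace $U$ of $V$, $U^{\perp'}$ is its orthogonal complement with respect to $\sigma'$. When $U_1\cap\cdots\cap U_t$ contains no $1$-dimensional $\mathbb{F}_{q^m}$-subspace,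 $(U_1^{\perp'},\ldots,U_t^{\perp'})$ spans $\mathbb{F}_{q^m}^k$ over $\mathbb{F}_{q^m}$, and the geometric dual of a code associated with $(U_1,\ldots,U_t)$ is a code associated with $(U_1^{\perp'},\ldots,U_t^{\perp'})$. Linear sets: for an $\mathbb{F}_q$-subspace $U$ of $\mathbb{F}_{q^m}^k$ of $\mathbb{F}_q$-dimension $n$, $L_U=\{\langle u\rangle_{\mathbb{F}_{q^m}}:u\in U\setminus\{0\}\}\subseteq\mathrm{PG}(k-1,q^m)$ is an $\mathbb{F}_q$-linear set of rank $n$. It (and $U$) is scattered if $\dim_{\mathbb{F}_q}(U\cap\langle v\rangle_{\mathbb{F}_{q^m}})\le1$ for all $v\ne0$. *)

(* Defs.v *)
From HB Require Import structures.
From mathcomp Require Import all_boot all_order all_fingroup all_algebra all_field.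
From mathcomp Require Import mathcomp_extra boolp classical_sets.

Set Implicit Arguments.
Unset Strict Implicit.
Unset Printing Implicit Defensive.

Import GRing.Theory.

Local Open Scope ring_scope.

(* F is F_q and L is F_{q^m}, m = \dim {:L}.  Every finite extension of a
   finite field is a splitting field, so L : splittingFieldType F is no
   restriction; it gives access to 'Gal({:L} / 1) and galTrace.

   F_{q^m}^k is used with two linear structures, carried by two types:
   - 'rV[L]_k, a vectType over L;
   - L ^ k (that is, {ffun 'I_k -> L}), a vectType over F.
   rowL is the identification of the second with the first. *)

Section TwoStructures.
Variables (F : finFieldType) (L : splittingFieldType F) (k : nat).

Definition rowL (u : L ^ k) : 'rV[L]_k := \row_i u i.

Definition colF (n : nat) (A : 'M[L]_(k, n)) (j : 'I_n) : L ^ k :=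
  [ffun i => A i j].

(* The L-span of v, as an F-subspace of L ^ k. *)
Definition Lline (v : 'rV[L]_k) : {vspace L ^ k} :=
  (linfun (fun a : L => [ffun i => a * v 0 i] : L ^ k) @: {:L})%VS.

Lemma rowL_is_additive : zmod_morphism rowL.
Proof. by move=> u v; apply/rowP=> i; rewrite !mxE !ffunE. Qed.

Lemma rowL_bij : bijective rowL.
Proof.
exists (fun v : 'rV[L]_k => [ffun i => v 0 i] : L ^ k) => [u|v].
  by apply/ffunP=> i; rewrite ffunE mxE.
by apply/rowP=> i; rewrite mxE ffunE.
Qed.

Lemma rowLZ (a : F) (u : L ^ k) : rowL (a *: u) = a%:A *: rowL u.
Proof. by apply/rowP=> i; rewrite !mxE ffunE -scalerAl mul1r. Qed.

Lemma mem_Lline (v : 'rV[L]_k) (u : L ^ k) :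
  (u \in Lline v) = (rowL u \in <[v]>%VS).
Proof.
pose f (a : L) : L ^ k := [ffun i => a * v 0 i].
have f_lin : linear f.
  move=> c a b; apply/ffunP=> i.
  by rewrite !ffunE mulrDl scalerAl.
pose fL : {linear L -> (L ^ k)%type} :=
  HB.pack f (GRing.isLinear.Build _ _ _ _ _ f_lin).
have fE a : linfun f a = f a by rewrite (lfunE fL).
apply/memv_imgP/vlineP=> [[a _ ->]|[a ua]]; exists a.
- by rewrite fE; apply/rowP=> i; rewrite !mxE ffunE.
- exact: memvf.
- by rewrite fE; apply/ffunP=> i; rewrite ffunE; move/rowP/(_ i): ua; rewrite !mxE.
Qed.

End TwoStructures.

Section LinearSets.
Variables (F : finFieldType) (L : splittingFieldType F) (k : nat).
Local Open Scope classical_set_scope.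

(* PG(k-1, q^m): its points are the 1-dimensional L-subspaces of L^k. *)
Definition PG : set {vspace 'rV[L]_k} := [set P | \dim P = 1%N].

Definition linear_set (U : {vspace L ^ k}) : set {vspace 'rV[L]_k} :=
  [set <[rowL u]>%VS | u in [set u | u \in U /\ u != 0]].

Definition scattered (U : {vspace L ^ k}) : Prop :=
  forall v : 'rV[L]_k, v != 0 -> (\dim (U :&: Lline v) <= 1)%N.

End LinearSets.

Arguments PG {F} L k.

Section Orthogonality.
Variables (F : finFieldType) (L : splittingFieldType F) (k : nat).

Section Form.
Variables (theta : {rmorphism L -> L}).

(* Sesquilinear forms on L^k: linear on the left, theta-semilinear on the
   right.  As L is finite, theta is automatically an automorphism. *)
Variable sigma : {bilinear 'rV[L]_k -> 'rV[L]_k -> L | *%R & theta \; *%R}.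

Definition reflexive_form : Prop :=
  forall x y, sigma x y = 0 -> sigma y x = 0.

Definition nondegenerate_form : Prop :=
  forall x, (forall y, sigma x y = 0) -> x = 0.

(* The trace L -> F, with F seen inside L as the subfield 1. *)
Definition trace_form (x y : L ^ k) : L :=
  galTrace 1%VS {:L} (sigma (rowL x) (rowL y)).

(* As for the library's orthov, orthogonality is imposed against a basis of U;
   mem_trace_orthov shows that this is orthogonality to all of U. *)
Definition trace_orthov (U : {vspace L ^ k}) : {vspace L ^ k} :=
  (\bigcap_(i < \dim U) lker (linfun (trace_form^~ (vbasis U)`_i)))%VS.

Lemma galTraceZ (c x : L) : c \in 1%VS ->
  galTrace 1%VS {:L} (c * x) = c * galTrace 1%VS {:L} x.
Proof.
move=> c1; rewrite /galTrace mulr_sumr; apply: eq_bigr => g gG.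
by rewrite rmorphM /= (fixed_gal _ gG) // sub1v.
Qed.

Lemma trace_form_linearl (z : L ^ k) : linear (trace_form^~ z).
Proof.
move=> a x y; rewrite /trace_form -[LHS]/(galTrace _ _ (sigma (rowL _) _)).
have -> : rowL (a *: x + y) = a%:A *: rowL x + rowL y.
  by apply/rowP=> i; rewrite !mxE !ffunE -scalerAl mul1r.
rewrite linearDl linearZl_LR raddfD /= galTraceZ ?rpredZ ?mem1v //.
by rewrite -scalerAl mul1r.
Qed.

Lemma trace_form_semilinearr (x : L ^ k) (a : F) (y z : L ^ k) :
  trace_form x (a *: y + z) = theta a%:A * trace_form x y + trace_form x z.
Proof.
have th1 : theta a%:A \in 1%VS.
  have : a%:A \in (1%AS : {subfield L}) by rewrite rpredZ ?mem1v.
  rewrite -[_ \in 1%VS]/(_ \in (1%AS : {subfield L})) !Fermat's_little_theorem.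
  by move=> /eqP aE; rewrite -rmorphXn aE.
rewrite /trace_form.
have -> : rowL (a *: y + z) = a%:A *: rowL y + rowL z.
  by apply/rowP=> i; rewrite !mxE !ffunE -scalerAl mul1r.
by rewrite linearDr linearZr_LR raddfD /= galTraceZ.
Qed.

Lemma mem_trace_orthov (U : {vspace L ^ k}) (x : L ^ k) :
  x \in trace_orthov U <-> (forall u, u \in U -> trace_form x u = 0).
Proof.
have linE z y : linfun (trace_form^~ z) y = trace_form y z.
  pose fL : {linear (L ^ k)%type -> L} := HB.pack (trace_form^~ z)
    (GRing.isLinear.Build _ _ _ _ _ (trace_form_linearl z)).
  by rewrite (lfunE fL).
have sum0 y : trace_form y 0 = 0.
  rewrite /trace_form; have -> : rowL (0 : L ^ k) = 0.
    by apply/rowP=> i; rewrite !mxE ffunE.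
  by rewrite linear0r raddf0.
rewrite memvE; split=> [/subv_bigcapP xU u uU | xU].
- rewrite (coord_vbasis uU); elim/big_rec: _ => [|i v _ v0]; first exact: sum0.
  rewrite trace_form_semilinearr v0 addr0.
  have := xU i isT; rewrite -memvE memv_ker linE => /eqP ->.
  by rewrite mulr0.
- apply/subv_bigcapP=> i _; rewrite -memvE memv_ker linE xU //.
  by rewrite vbasis_mem // memt_nth.
Qed.

End Form.
End Orthogonality.

Section SumRankCodes.
Variables (F : finFieldType) (L : splittingFieldType F).

Definition rank_weight (n : nat) (v : 'rV[L]_n) : nat :=
  \dim <<[seq (v 0 j)%R | j : 'I_n]>>%VS.

Section Blocks.
Variables (t : nat) (N : 'I_t -> nat).
Implicit Types (c : 'rV[L]_(\sum_i N i)) (C : {vspace 'rV[L]_(\sum_i N i)}).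
Local Open Scope classical_set_scope.

Definition rank_list c : t.-tuple nat :=
  [tuple rank_weight (submxrow c i) | i < t].

Definition sum_rank_weight c : nat :=
  (\sum_(i < t) rank_weight (submxrow c i))%N.

Definition nonzero_weights C : set nat :=
  [set w | w != 0%N /\ exists2 c, c \in C & sum_rank_weight c = w].

Definition rank_lists C : set (t.-tuple nat) :=
  [set rank_list c | c in [set c | c \in C /\ c != 0]].

(* C is generated by (G_1 | ... | G_t), the columns of G_i forming an F-basis
   of V_i.  That the V_i together span L^k over L is not part of the
   definition: it amounts to \dim C = k. *)
Definition associated_code k (V : 'I_t -> {vspace L ^ k}) C : Prop :=
  exists2 G : forall i, 'M[L]_(k, N i),
    forall i, basis_of (V i) [seq colF (G i) j | j : 'I_(N i)] &
    C = <<[seq row r (\mxrow_i G i) | r : 'I_k]>>%VS.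

End Blocks.
End SumRankCodes.

(* Main.v *)
(* A codeword of C is x (G_1 | ... | G_t) with x in L^k, and by nondegeneracy
   y |-> x . y is sigma(-, w) for a unique w in L^k.  Its kernel is the
   orthogonal of the L-line <w>, so the i-th block has rank
     dim U_i^perp - dim (U_i + <w>)^perp = m - dim (U_i :&: <w>).
   Since U_i is scattered this is m or m - 1, the latter exactly when the point
   <w> lies on L_{U_i}; by disjointness this happens for at most one i, and by
   U_cover and n_i >= 1 all t + 1 cases occur. *)
From HB Require Import structures.
Require Import Defs.
From mathcomp Require Import all_boot all_order all_fingroup all_algebra all_field.
From mathcomp Require Import mathcomp_extra boolp classical_sets.
From mathcomp Require Import zify.

Set Implicit Arguments.
Unset Strict Implicit.
Unset Printing Implicit Defensive.

Local Open Scope classical_set_scope.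
Local Open Scope ring_scope.
Import GRing.Theory.

Lemma linear_linfunE (K : fieldType) (aT rT : vectType K) (f : aT -> rT) :
  linear f -> linfun f =1 f.
Proof.
move=> f_lin.
pose fL : {linear aT -> rT} := HB.pack f (GRing.isLinear.Build _ _ _ _ _ f_lin).
exact: (lfunE fL).
Qed.

(** * Trace, lines, linear sets and ranks, measured by dimensions over [F] *)

Section Spaces.
Context {F : finFieldType} {L : splittingFieldType F} {k : nat}.
Implicit Types (w x : 'rV[L]_k) (u y : L ^ k) (U W V : {vspace L ^ k}).

(** The trace is the sum of the automorphisms with all coefficients 1, so their linear independence
    makes it nonzero at some [a]; test the hypothesis at [a / s]. *)
Lemma galTrace_nondeg (s : L) :
  (forall a, galTrace 1%VS {:L} (a * s) = 0) -> s = 0.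
Proof.
move=> tr0; apply/eqP/negP => /negP s0.
have [|a _ /negP[]] := @gal_independent_contra F L {:L}%AS
  (fun g => g \in 'Gal({:L} / 1)%g) (fun=> 1) 1%g (group1 _).
  exact: oner_neq0.
have /eqP := tr0 (a / s); rewrite divfK // /galTrace.
by under eq_bigr do rewrite -[_ a]mul1r.
Qed.

(** An extension of finite fields is Galois, so the fixed field, where the trace lands, is the
    base. *)
Lemma galTrace_in1 (x : L) : galTrace 1%VS {:L} x \in 1%VS.
Proof.
have /galois_fixedField E : galois (1%AS : {subfield L}) {:L}%AS.
  exact: finField_galois (sub1v _).
by have := @galTrace_fixedField F L 1%AS {:L}%AS x (memvf x); rewrite E.
Qed.

Lemma dim_ffun_field : \dim {:(L ^ k)%type} = (\dim {:L} * k)%N.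
Proof. by rewrite !dimvf mulnC -[in RHS](card_ord k). Qed.

Lemma dim_Lline w : w != 0 -> \dim (Lline w) = \dim {:L}.
Proof.
move=> w0; pose f (a : L) : L ^ k := [ffun i => a * w 0 i].
have f_lin : linear f.
  by move=> c a b; apply/ffunP=> i; rewrite !ffunE mulrDl scalerAl.
apply: limg_dim_eq; apply/eqP; rewrite capfv.
apply/lker0P => a b; rewrite !(linear_linfunE f_lin) => /ffunP ab.
have [i wi] : exists i, w 0 i != 0 by apply/rV0Pn.
by have := ab i; rewrite !ffunE => /(mulIf wi).
Qed.

(** Any nonzero vector of [U :&: Lline w] generates [<[w]>]. Incidence thus becomes a condition on
    the same number that [scattered] bounds. *)
Lemma mem_linear_set U w : w != 0 ->
  linear_set U <[w]>%VS <-> (0 < \dim (U :&: Lline w))%N.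
Proof.
move=> w0; rewrite lt0n dimv_eq0; split=> [[u [uU u0] uw] | /eqP UW0].
  apply/eqP => UW0; case/eqP: u0; apply/eqP.
  by rewrite -memv0 -UW0 memv_cap uU mem_Lline -uw memv_line.
exists (vpick (U :&: Lline w)); last first.
  have := memv_pick (U :&: Lline w); rewrite memv_cap mem_Lline => /andP[_ pw].
  apply/eqP; rewrite eqEdim -memvE pw !dim_vline w0 /= lt0b.
  apply/eqP => p0; apply: UW0; apply/eqP; rewrite -vpick0; apply/eqP/ffunP=> i.
  by move/rowP: p0 => /(_ i); rewrite !mxE ffunE.
split; last by rewrite vpick0; apply/eqP.
by have := memv_pick (U :&: Lline w); rewrite memv_cap => /andP[].
Qed.

Definition dot_fun x : 'Hom((L ^ k)%type, L) :=
  linfun (fun y : L ^ k => \sum_i x 0 i * y i).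

Lemma dot_funE x y : dot_fun x y = \sum_i x 0 i * y i.
Proof.
apply: linear_linfunE y => c a b; rewrite scaler_sumr -big_split.
by apply: eq_bigr => i _; rewrite /= !ffunE mulrDr scalerAr.
Qed.

(** Rank-nullity for [dot_fun x] on [V]: the entries of [x *m G] are the values of [dot_fun x] on a
    basis of [V], so they span its image. *)
Lemma rank_weight_mul n V (G : 'M[L]_(k, n)) x :
  basis_of V [seq colF G j | j : 'I_n] ->
  (\dim (V :&: lker (dot_fun x)) + rank_weight (x *m G) = \dim V)%N.
Proof.
move=> /andP[/eqP VE _]; rewrite -(limg_ker_dim (dot_fun x) V); congr (_ + _)%N.
rewrite -VE limg_span -map_comp /rank_weight; congr (\dim <<_>>).
apply: eq_map => j /=; rewrite dot_funE mxE.
by apply: eq_bigr => i _; rewrite ffunE.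
Qed.

(** Each map has an image of dimension at most 1 over [F], so intersecting with its kernel costs at
    most one dimension. *)
Lemma dim_bigcap_lker n (f : 'I_n -> 'Hom((L ^ k)%type, L)) :
  (forall i, limg (f i) <= 1)%VS ->
  (\dim {:(L ^ k)%type} <= \dim (\bigcap_(i < n) lker (f i)) + n)%N.
Proof.
elim: n f => [|n IHn] f f1; first by rewrite big_ord0 addn0.
rewrite big_ord_recr /=; set A := (\bigcap_(i < n) _)%VS.
have An := IHn (fun i => f (widen_ord (leqnSn n) i)) (fun i => f1 _).
apply: (leq_trans An); rewrite -addSnnS leq_add2r.
rewrite -(limg_ker_dim (f ord_max) A) -addn1 leq_add2l.
have /dimvS := subv_trans (limgS (f ord_max) (subvf A)) (f1 ord_max).
by rewrite dimv1.
Qed.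

(** * Orthogonality for the trace form, and codewords as polar functionals *)

Section Form.
Context {theta : {rmorphism L -> L}}
  (sigma : {bilinear 'rV[L]_k -> 'rV[L]_k -> L | *%R & theta \; *%R}).

Local Notation orth := (trace_orthov sigma).

Lemma dim_trace_orthov_ge U :
  (\dim {:(L ^ k)%type} <= \dim (orth U) + \dim U)%N.
Proof.
apply: dim_bigcap_lker => i.
apply/subvP => _ /memv_imgP[y _ ->].
rewrite (linear_linfunE (trace_form_linearl sigma _)); exact: galTrace_in1.
Qed.

Lemma trace_orthovD U W : orth (U + W) = (orth U :&: orth W)%VS.
Proof.
apply/vspaceP => y; rewrite memv_cap.
apply/idP/andP => [/mem_trace_orthov yUW |].
  by split; apply/mem_trace_orthov => u uU; apply: yUW;
    rewrite (subvP _ _ uU) ?addvSl ?addvSr.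
case=> /mem_trace_orthov yU /mem_trace_orthov yW.
apply/mem_trace_orthov => _ /memv_addP[u uU [v vW ->]].
by rewrite -[u]scale1r trace_form_semilinearr yU // yW // mulr0 addr0.
Qed.

Lemma theta_surj (b : L) : exists a, theta a = b.
Proof.
have [g _ gK] : bijective theta.
  exact: (@injF_bij (finvect_type L) theta (fmorph_inj theta)).
by exists (g b).
Qed.

(** Against [a *: w] the trace form is the trace of [theta a * sigma (rowL y) w]. As [theta a] runs
    over all of [L], [galTrace_nondeg] removes the trace. *)
Lemma mem_orth_Lline w y :
  (y \in orth (Lline w)) = (sigma (rowL y) w == 0).
Proof.
apply/idP/eqP => [/mem_trace_orthov yw | yw].
  apply: galTrace_nondeg => b; have [a <-] := theta_surj b.
  have := yw [ffun i => a * w 0 i]; rewrite /trace_form.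
  have -> : rowL ([ffun i => a * w 0 i] : L ^ k) = a *: w.
    by apply/rowP => i; rewrite !mxE ffunE.
  by rewrite linearZr_LR; apply; rewrite mem_Lline; apply/vlineP; exists a;
    apply/rowP => i; rewrite !mxE ffunE.
apply/mem_trace_orthov => u; rewrite mem_Lline => /vlineP[a ua].
by rewrite /trace_form ua linearZr_LR /= yw mulr0 raddf0.
Qed.

Hypothesis sigma_nondeg : nondegenerate_form sigma.

Lemma trace_orthov_fullv : orth {:(L ^ k)%type} = 0%VS.
Proof.
apply/eqP; rewrite -subv0; apply/subvP => y /mem_trace_orthov y0.
rewrite memv0; apply/eqP/(bij_inj (@rowL_bij F L k)).
have -> : rowL (0 : L ^ k) = 0 by apply/rowP=> i; rewrite !mxE ffunE.
apply: sigma_nondeg => w; apply/eqP; rewrite -mem_orth_Lline.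
by apply/mem_trace_orthov => u _; apply: y0; rewrite memvf.
Qed.

(* The orthogonals of U and of a complement of U meet trivially, and neither
   is smaller than expected. *)
Lemma dim_trace_orthov U :
  (\dim (orth U) + \dim U = \dim {:(L ^ k)%type})%N.
Proof.
have := dimv_sum_cap (orth U) (orth U^C).
rewrite -trace_orthovD addv_complf trace_orthov_fullv dimv0 addn0 => dUC.
have := dim_trace_orthov_ge U; have := dim_trace_orthov_ge U^C.
have := dimvS (subvf (orth U + orth U^C)); have := dimvS (subvf U).
rewrite dimv_compl dUC; lia.
Qed.

Definition polar_row w : 'rV[L]_k := \row_i sigma (delta_mx 0 i) w.

Lemma dot_fun_polar w y : dot_fun (polar_row w) y = sigma (rowL y) w.
Proof.
rewrite dot_funE [rowL y]row_sum_delta linear_sumlz /=; apply: eq_bigr => i _.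
by rewrite linearZl_LR /= !mxE mulrC.
Qed.

Lemma lker_dot_fun_polar w : lker (dot_fun (polar_row w)) = orth (Lline w).
Proof. by apply/vspaceP => y; rewrite memv_ker dot_fun_polar mem_orth_Lline. Qed.

Hypothesis sigma_refl : reflexive_form sigma.

(** Injectivity suffices by finiteness. Nondegeneracy is stated for the left argument while [w] sits
    on the right; reflexivity swaps them. *)
Lemma polar_row_surj x : exists w, polar_row w = x.
Proof.
have pinj : injective polar_row.
  move=> v w vw; apply/eqP; rewrite -subr_eq0; apply/eqP.
  apply: sigma_nondeg => y; apply: sigma_refl.
  have [u <-] : exists u, rowL u = y.
    by have [g _ gK] := @rowL_bij F L k; exists (g y).
  by rewrite linearBr /= -!dot_fun_polar vw subrr.
have [g _ gK] : bijective polar_row.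
  exact: (@injF_bij 'rV[finvect_type L]_k polar_row pinj).
by exists (g x).
Qed.

(** The kernel inside [orth U] is [orth (U + Lline w)], so the rank is the dimension of
    [U + Lline w] minus that of [U]; conclude by the dimension formula for sums. *)
Lemma rank_weight_polar n U (G : 'M[L]_(k, n)) w : w != 0 ->
  basis_of (orth U) [seq colF G j | j : 'I_n] ->
  (rank_weight (polar_row w *m G) + \dim (U :&: Lline w) = \dim {:L})%N.
Proof.
move=> w0 /(rank_weight_mul (polar_row w)).
rewrite lker_dot_fun_polar -trace_orthovD => rkE.
have dU := dim_trace_orthov U; have dUw := dim_trace_orthov (U + Lline w).
have dcap := dimv_sum_cap U (Lline w); rewrite (dim_Lline w0) in dcap.
lia.
Qed.

End Form.

End Spaces.

(** * Codes as images of generator matrices, and weights from rank-lists *)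

Section Code.
Context {F : finFieldType} {L : splittingFieldType F}.
Context {k t : nat} {N : 'I_t -> nat}.

Lemma associated_codeP (V : 'I_t -> {vspace L ^ k})
    (C : {vspace 'rV[L]_(\sum_i N i)}) :
  associated_code V C -> exists2 G : forall i, 'M[L]_(k, N i),
    forall i, basis_of (V i) [seq colF (G i) j | j : 'I_(N i)] &
    C = limg (linfun (mulmxr (\mxrow_i G i) : 'rV[L]_k -> _)).
Proof.
case=> G GV ->; exists G => //; set M := \mxrow_i G i.
apply/eqP; rewrite eqEsubv; apply/andP; split.
  apply/span_subvP => _ /mapP[r _ ->]; rewrite rowE.
  by apply/memv_imgP; exists (delta_mx 0 r); rewrite ?memvf // lfunE.
apply/subvP => _ /memv_imgP[x _ ->]; rewrite lfunE /= mulmx_sum_row.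
apply: memv_suml => r _; apply/memvZ/memv_span/mapP.
by exists r => //; apply: mem_enum.
Qed.

Lemma sum_rank_weightE (c : 'rV[L]_(\sum_i N i)) :
  sum_rank_weight c = (\sum_(i < t) tnth (rank_list c) i)%N.
Proof. by apply: eq_bigr => i _; rewrite tnth_mktuple. Qed.

End Code.

Lemma sum_all_but_one t (i : 'I_t) m : (0 < m)%N ->
  (\sum_(j < t) (if j == i then m - 1 else m) = t * m - 1)%N.
Proof.
move=> m0; have := sum_nat_const 'I_t m; rewrite card_ord (bigD1 i) //= => tm.
rewrite (bigD1 i) //= eqxx -tm -addnBAC //; congr (_ + _)%N.
by apply: eq_bigr => j /negPf ->.
Qed.

Theorem theorem4p17 (F : finFieldType) (L : splittingFieldType F) (m k t : nat)
    (hm : \dim {:L} = m)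
    (theta : {rmorphism L -> L})
    (sigma : {bilinear 'rV[L]_k -> 'rV[L]_k -> L | *%R & theta \; *%R})
    (sigma_refl : reflexive_form sigma)
    (sigma_nondeg : nondegenerate_form sigma)
    (n : 'I_t -> nat) (U : 'I_t -> {vspace L ^ k})
    (U_rank : forall i, \dim (U i) = n i)
    (n_noninc : forall i j : 'I_t, (i <= j)%N -> (n j <= n i)%N)
    (n_ge1 : forall i, (1 <= n i)%N)
    (U_scattered : forall i, scattered (U i))
    (U_disjoint : trivIset [set: 'I_t] (fun i => linear_set (U i)))
    (U_cover : \bigcup_(i in [set: 'I_t]) linear_set (U i) <> PG L k)
    (U_cap : forall v : 'rV[L]_k, v != 0 ->
       ~~ (Lline v <= \bigcap_(i < t) U i)%VS)
    (N : 'I_t -> nat) (C : {vspace 'rV[L]_(\sum_(i < t) N i)})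
    (C_dual : associated_code (fun i => trace_orthov sigma (U i)) C) :
  [/\ (forall i, N i = m * k - n i)%N /\ \dim C = k,
      (t * m)%N != (t * m - 1)%N,
      nonzero_weights C = [set (t * m)%N; (t * m - 1)%N] &
      rank_lists C =
        [set [tuple m | _ < t]] `|`
        [set [tuple if j == i then (m - 1)%N else m | j < t] | i in [set: 'I_t]]].
Proof.
have [G GV ->] := associated_codeP C_dual; set f := linfun _.
have m_gt0 : (0 < m)%N by rewrite -hm adim_gt0.
(* Codewords are indexed by the polar vector [w] instead of the message, so that block ranks depend
   on the point [<[w]>]. *)
pose cw w := f (polar_row sigma w).
have cwP c : c \in limg f -> exists w, c = cw w.
  move=> /memv_imgP[x _ ->].
  by have [w <-] := polar_row_surj sigma_nondeg sigma_refl x; exists w.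
have cw_in w : cw w \in limg f by rewrite memv_img ?memvf.
have polar0 : polar_row sigma 0 = 0 by apply/rowP => i; rewrite !mxE linear0r.
have cw0 : cw 0 = 0 by rewrite /cw polar0 raddf0.
have rk (w : 'rV[L]_k) i : w != 0 ->
    (rank_weight (submxrow (cw w) i) + \dim (U i :&: Lline w) = m)%N.
  move=> w0; rewrite -hm /cw lfunE /= mul_mxrow mxrowK.
  exact: (rank_weight_polar sigma_nondeg w0 (GV i)).
have wt0 (w : 'rV[L]_k) : w != 0 -> sum_rank_weight (cw w) != 0%N.
  move=> w0; apply/negP; rewrite sum_nat_eq0 => /forallP rk0.
  (* If every block had rank 0, then each [U i] would contain the whole of [Lline w]. *)
  case/negP: (U_cap w w0); apply/subv_bigcapP => i _.
  have := rk w i w0; rewrite (eqP (rk0 i)) add0n -hm -(dim_Lline w0) => dU.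
  by apply/capv_idPr/eqP; rewrite eqEdim capvSr dU leqnn.
have wtz : sum_rank_weight (0 : 'rV[L]_(\sum_i N i)) = 0%N.
  apply: big1 => i _; apply/eqP; rewrite dimv_eq0 -subv0.
  apply/span_subvP => _ /mapP[j _ ->].
  by rewrite !mxE mem0v.
have cw_neq0 (w : 'rV[L]_k) : w != 0 -> cw w != 0.
  by move=> /wt0; apply: contraNneq => ->; rewrite wtz.
have cw_eq0 (w : 'rV[L]_k) : cw w != 0 -> w != 0.
  by apply: contraNneq => ->; rewrite cw0.
have cap1 (w : 'rV[L]_k) i : w != 0 -> (\dim (U i :&: Lline w) <= 1)%N.
  exact: U_scattered.
have list_none (w : 'rV[L]_k) :
    w != 0 -> (forall i, ~ linear_set (U i) <[w]>%VS) ->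
    rank_list (cw w) = [tuple m | _ < t].
  move=> w0 wU; apply: eq_from_tnth => i; rewrite !tnth_mktuple.
  have := rk w i w0; have := mem_linear_set (U i) w0.
  case: (\dim _) => [|d] [_ H]; first by rewrite addn0.
  by case: (wU i); apply: H.
have list_one (w : 'rV[L]_k) i : w != 0 -> linear_set (U i) <[w]>%VS ->
    rank_list (cw w) = [tuple if j == i then (m - 1)%N else m | j < t].
  move=> w0 wU; apply: eq_from_tnth => j; rewrite !tnth_mktuple.
  have := rk w j w0; have := cap1 w j w0; have := mem_linear_set (U j) w0.
  case: eqP => [-> [/(_ wU) + _]|ji [_ H]].
    (* At the index [i] itself the intersection has dimension positive and at most 1, hence exactly
       1. *)
    by move: (rank_weight _) (\dim _) => r d; lia.
  case: (\dim _) H => [|d] H; first by rewrite addn0.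
  (* A positive dimension at [j] would put [<[w]>] on two of the disjoint linear sets. *)
  by case: ji; apply: U_disjoint => //; exists <[w]>%VS; split => //; apply: H.
have lists (w : 'rV[L]_k) : w != 0 -> rank_list (cw w) = [tuple m | _ < t] \/
    exists i,
      rank_list (cw w) = [tuple if j == i then (m - 1)%N else m | j < t].
  move=> w0; have [[i wi]|] := pselect (exists i, linear_set (U i) <[w]>%VS).
    by right; exists i; apply: list_one.
  by move=> /forallNP wN; left; apply: list_none.
have [w1 w1_neq0 w1E] :
    exists2 w, w != 0 & rank_list (cw w) = [tuple m | _ < t].
  (* Otherwise every point, being generated by its [vpick], would lie on some linear set, against
     [U_cover]. *)
  apply: contrapT => noP.
  case: U_cover; apply/seteqP; split=> [_ [i _ [u [uU u0] <-]]|P P1].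
    rewrite /PG /= dim_vline; case: eqP => // /rowP u00.
    by case/eqP: u0; apply/ffunP => j; have := u00 j; rewrite !mxE ffunE.
  have dP : \dim P = 1%N := P1.
  have v0 : vpick P != 0 by rewrite vpick0 -dimv_eq0 dP.
  have PE : P = <[vpick P]>%VS.
    by apply/eqP; rewrite eq_sym eqEdim -memvE memv_pick dim_vline v0 dP.
  apply: contrapT => nP; apply: noP; exists (vpick P) => //.
  by apply: list_none => // i; rewrite -PE => iP; apply: nP; exists i.
have t_gt0 : (0 < t)%N.
  (* For [t = 0] the empty intersection is the full space, which contains [Lline w1]. *)
  rewrite lt0n; apply: contraNN (U_cap w1 w1_neq0) => /eqP t0.
  by apply/subv_bigcapP => -[i lt_i]; exfalso; rewrite t0 in lt_i.
have w2P i : exists2 w, w != 0 &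
    rank_list (cw w) = [tuple if j == i then (m - 1)%N else m | j < t].
  (* Since [n i] is positive, [U i] has a nonzero vector, whose point lies on the [i]-th linear
     set. *)
  have u0 : vpick (U i) != 0 by rewrite vpick0 -dimv_eq0 -lt0n U_rank.
  have w0 : rowL (vpick (U i)) != 0.
    apply: contraNneq u0 => /rowP w0.
    by apply/eqP/ffunP => j; have := w0 j; rewrite !mxE ffunE.
  exists (rowL (vpick (U i))) => //; apply: list_one => //.
  by exists (vpick (U i)) => //; split; rewrite ?memv_pick.
have wt_all (c : 'rV[L]_(\sum_(i < t) N i)) :
    rank_list c = [tuple m | _ < t] -> sum_rank_weight c = (t * m)%N.
  move=> cE; rewrite sum_rank_weightE cE.
  by under eq_bigr do rewrite tnth_mktuple; rewrite sum_nat_const card_ord.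
have wt_one (c : 'rV[L]_(\sum_(i < t) N i)) i :
    rank_list c = [tuple if j == i then (m - 1)%N else m | j < t] ->
    sum_rank_weight c = (t * m - 1)%N.
  move=> cE; rewrite sum_rank_weightE cE.
  by under eq_bigr do rewrite tnth_mktuple; apply: sum_all_but_one.
split.
- split=> [i|].
    have Ni :=
      size_basis (X := [tuple of [seq colF (G i) j | j : 'I_(N i)]]) (GV i).
    have := dim_trace_orthov sigma_nondeg (U i).
    by rewrite Ni card_ord U_rank dim_ffun_field hm => <-; rewrite addnK.
  rewrite limg_dim_eq; first by rewrite dimvf dim_matrix; apply: mul1n.
  (* Encoding is injective: a message is the polar row of some [w], and a nonzero [w] gives a
     nonzero codeword. *)
  apply/eqP; rewrite capfv -subv0; apply/subvP => x; rewrite memv_ker memv0.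
  have [w <-] := polar_row_surj sigma_nondeg sigma_refl x => fw0.
  have [->|/cw_neq0] := eqVneq w 0; first by rewrite polar0.
  by rewrite /cw fw0.
(* Subtraction is truncated, so positivity of [t * m] is what separates the two weights. *)
- by apply/eqP; have := muln_gt0 t m; lia.
- apply/seteqP; split=> [x [/eqP x0 [c /cwP[w ->] cE]]|_ [] ->].
  + have w0 : w != 0 by apply: contra_not_neq x0 => w0; rewrite -cE w0 cw0.
    by rewrite -cE; have [/wt_all|[i /wt_one]] := lists w w0; [left|right].
  + by rewrite -(wt_all _ w1E); split; [apply: wt0 | exists (cw w1)].
  + have [w w0 /wt_one <-] := w2P (Ordinal t_gt0).
    by split; [apply: wt0 | exists (cw w)].
- apply/seteqP; split=> [_ [_ [/cwP[w ->] /cw_eq0 w0] <-]|_ [->|[i _ <-]]].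
  + by have [->|[i ->]] := lists w w0; [left|right; exists i].
  + by exists (cw w1) => //; split=> //; apply: cw_neq0.
  + have [w w0 <-] := w2P i.
    by exists (cw w) => //; split=> //; apply: cw_neq0.
Qed.
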